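(* Let $T\ge 1$ be an integer, and for each $t=1,\dots,T$ let $F_t=(1-\alpha_t)I+\alpha_t T_t:\mathcal D\to\mathcal D$ be an $\alpha_t$-averaged operator, where $\alpha_t\in(0,1)$ and $T_t:\mathcal D\to\mathcal D$ is non-expansive. Let $\{x_t^\star\}_{t=1}^T\subset\mathcal D$ satisfy $x_t^\star=F_t(x_t^\star)$ for each $t=1,\dots,T$, and let $\sigma_1,\dots,\sigma_T$ be finite non-negative scalars with $\|x_{t+1}^\star-x_t^\star\|\le\sigma_t$ for all $t$ (i.e. for $1\le t\le T-1$). For each $t=1,\dots,T$, let $\hat T_t:\mathcal D\to\mathcal D$ be a map, put $\hat F_t:=(1-\alpha_t)I+\alpha_t\hat T_t$, and assume: (1) (bounded approximation error) there is a finite scalar $e_t$ with $\|T_t(x)-\hat T_t(x)\|\le e_t$ for all $x\in\mathcal D$; (2) (Lipschitz maps) there is a scalar $0\le L_t\le 1$ with $\|F_t(x)-F_t(x')\|\le L_t\|x-x'\|$ for all $x,x'\in\mathcal D$; (3) (bounded maps) there is a finite scalar $M_t$ with $\|F_t(x)\|\le M_t$ and $\|\hat F_t(x)\|\le M_t$ for all $x\in\mathcal D$. Let $x_1\in\mathcal D$ and let $\{x_t\}$ be generated by the inexact running Krasnosel'skii-Mann algorithm $x_{t+1}=\hat F_t(x_t)=(1-\alpha_t)x_t+\alpha_t\hat T_t(x_t)$. Then $$\sum_{t=1}^T\alpha_t(1-\alpha_t)\|x_t-T_t(x_t)\|^2\le\|x_1-x_1^\star\|^2+\sum_{t=1}^T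 r_t,$$ where $r_t:=\alpha_t e_t(4M_t+\alpha_t e_t)+\sigma_t(4M_t+\sigma_t)$. In particular, $$\frac1T\sum_{t=1}^T\alpha_t(1-\alpha_t)\|x_t-T_t(x_t)\|^2\le\frac1T\|x_1-x_1^\star\|^2+r,$$ $$\frac1T\sum_{t=1}^T\frac{1-\alpha_t}{\alpha_t}\|x_t-F_t(x_t)\|^2\le\frac1T\|x_1-x_1^\star\|^2+r,$$ where $r:=\alpha e(4M+\alpha e)+\sigma(4M+\sigma)$ with $\alpha:=\sup_t\alpha_t$, $e:=\sup_t e_t$, $M:=\sup_t M_t$, $\sigma:=\sup_t\sigma_t$.
   Context: The ambient space is $\mathbb R^m$ with norm $\|\cdot\|$ induced by an inner product (e.g. the Euclidean norm), and $\mathcal D\subseteq\mathbb R^m$ is a nonempty closed convex set. $I$ is the identity operator. An operator $S:\mathcal D\to\mathcal D$ is non-expansive if $\|S(x)-S(y)\|\le\|x-y\|$ for all $x,y\in\mathcal D$. An operator $F:\mathcal D\to\mathcal D$ is $\alpha$-averaged, $\alpha\in(0,1)$, if $F=(1-\alpha)I+\alpha S$ for some non-expansive $S$. The suprema are over the indices $t=1,\dots,T$. The symbol $T$ without subscript is the number of steps, while $T_t$ denotes an operator. *)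

(* Defs.v *)
From HB Require Import structures.
From mathcomp Require Import all_boot all_order all_algebra.
From mathcomp Require Import all_classical all_reals all_analysis.

Set Implicit Arguments.
Unset Strict Implicit.
Unset Printing Implicit Defensive.

Import Order.TTheory GRing.Theory Num.Theory.
Import numFieldNormedType.Exports.
Local Open Scope classical_set_scope.
Local Open Scope ring_scope.

(* The inner product is an arbitrary [dot : {dot 'rV[R]_m for idfun}] (bilinear,
   symmetric, positive definite).  The library norm [`|u|] on 'rV[R]_m is the
   max norm, which is not induced by an inner product for m > 1. *)
Definition ipnorm (R : realType) (m : nat) (dot : {dot 'rV[R]_m for idfun})
    (u : 'rV[R]_m) : R :=
  Num.sqrt (dot u u).

(* Operators on D are total functions on 'rV[R]_m; only their values on D
   are constrained. *)
Definition lipschitz_in (R : realType) (m : nat)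
    (dot : {dot 'rV[R]_m for idfun}) (D : set 'rV[R]_m) (L : R)
    (S : 'rV[R]_m -> 'rV[R]_m) : Prop :=
  forall x y, D x -> D y -> ipnorm dot (S x - S y) <= L * ipnorm dot (x - y).

Definition nonexpansive_in (R : realType) (m : nat)
    (dot : {dot 'rV[R]_m for idfun}) (D : set 'rV[R]_m)
    (S : 'rV[R]_m -> 'rV[R]_m) : Prop :=
  forall x y, D x -> D y -> ipnorm dot (S x - S y) <= ipnorm dot (x - y).

Definition relax (R : realType) (m : nat) (a : R)
    (S : 'rV[R]_m -> 'rV[R]_m) (x : 'rV[R]_m) : 'rV[R]_m :=
  (1 - a) *: x + a *: S x.

(* Yields r_t at the step-t values, and r at the suprema. *)
Definition residual (R : realType) (a e M s : R) : R :=
  a * e * (4 * M + a * e) + s * (4 * M + s).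

Definition sup_steps (R : realType) (T : nat) (u : nat -> R) : R :=
  sup [set u t | t in [set t | (1 <= t <= T)%N]].

(* Main.v *)
Require Import Defs.
From HB Require Import structures.
From mathcomp Require Import all_boot all_order all_algebra.
From mathcomp Require Import all_classical all_reals all_analysis.
From mathcomp Require Import ring lra.

Set Implicit Arguments.
Unset Strict Implicit.
Unset Printing Implicit Defensive.

Import Order.TTheory GRing.Theory Num.Theory.
Import numFieldNormedType.Exports.
Local Open Scope classical_set_scope.
Local Open Scope ring_scope.

(** The potential is the squared distance from the iterate to the current fixed
    point, ||x_t - xstar_t||^2, and the regret bound is the telescoped sum of its
    one-step changes.  Such a change has three parts.

    - Exact step ([relax_fejer]).  An averaged operator F brings every point x
      closer to each fixed point y, with a quantified gain:
      ||F x - y||^2 <= ||x - y||^2 - a (1 - a) ||x - S x||^2.  This is the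
      identity ||(1-a) u + a v||^2
      = (1-a) ||u||^2 + a ||v||^2 - a (1-a) ||u - v||^2
      at u = x - y and v = S x - y, since nonexpansiveness of S gives
      ||v|| <= ||u||.

    - Inexact evaluation.  Replacing S by Shat moves F x by at most a * e.

    - Drift.  Passing from xstar_t to xstar_(t+1) moves the reference point by at
      most sigma_t.

    The last two are perturbations, of sizes s = a * e and s = sigma_t, of a vector
    joining two points in the ball of radius M_t: here it matters that a fixed
    point is itself a value of F_t, hence bounded by M_t.  Such a vector has
    length at most 2 M_t, so its square grows by at most 2 s (2 M_t) + s^2
    = s (4 M_t + s) ([ipnorm_perturb]).  The two contributions add up to the
    residual r_t ([inexact_step]).

    The averaged forms follow because the residual is monotone in its four
    arguments, so that r_t <= r at the suprema, and because
    x - F x = a (x - S x). *)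

(** * Inner-product geometry *)

Section InnerProduct.
Variables (R : realType) (m : nat) (dot : {dot 'rV[R]_m for idfun}).
Implicit Types (u v w : 'rV[R]_m) (a : R).

Lemma dotC u v : dot u v = dot v u.
Proof. by rewrite (hermC dot) /= expr0 mul1r. Qed.

Lemma dotDl u v w : dot (u + v) w = dot u w + dot v w.
Proof. exact: linearDl. Qed.

Lemma dotZl a u w : dot (a *: u) w = a * dot u w.
Proof. exact: linearZl_LR. Qed.

Lemma dotDr u v w : dot w (u + v) = dot w u + dot w v.
Proof. by rewrite dotC dotDl !(dotC w). Qed.

Lemma dotZr a u w : dot w (a *: u) = a * dot w u.
Proof. by rewrite dotC dotZl (dotC w). Qed.

Lemma dotNl u w : dot (- u) w = - dot u w.
Proof. by rewrite -scaleN1r dotZl mulN1r. Qed.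

Lemma dotNr u w : dot w (- u) = - dot w u.
Proof. by rewrite dotC dotNl (dotC w). Qed.

Lemma dot0l w : dot 0 w = 0.
Proof. by rewrite -(scale0r w) dotZl mul0r. Qed.

Lemma dot0r w : dot w 0 = 0.
Proof. by rewrite dotC dot0l. Qed.

Definition dotE := (dotDl, dotDr, dotZl, dotZr, dotNl, dotNr).

Lemma dot_ge0 u : 0 <= dot u u.
Proof.
have [->|u0] := eqVneq u 0; last exact/ltW/neq0_dnorm_gt0.
by rewrite dot0l.
Qed.

Lemma ipnorm_ge0 u : 0 <= ipnorm dot u.
Proof. exact: sqrtr_ge0. Qed.

Lemma ipnorm_sqr u : ipnorm dot u ^+ 2 = dot u u.
Proof. by rewrite sqr_sqrtr// dot_ge0. Qed.

Lemma ipnormZ_sqr a u : ipnorm dot (a *: u) ^+ 2 = a ^+ 2 * ipnorm dot u ^+ 2.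
Proof. by rewrite !ipnorm_sqr !dotE mulrA. Qed.

Lemma ipnormZ_ge0 a u : 0 <= a -> ipnorm dot (a *: u) = a * ipnorm dot u.
Proof.
move=> a0; apply/(@pexpIrn _ 2) => //.
- by rewrite nnegrE ipnorm_ge0.
- by rewrite nnegrE mulr_ge0// ipnorm_ge0.
- by rewrite ipnormZ_sqr exprMn.
Qed.

Lemma ipnormN u : ipnorm dot (- u) = ipnorm dot u.
Proof. by rewrite /ipnorm !dotE opprK. Qed.

Lemma ipdistC u v : ipnorm dot (u - v) = ipnorm dot (v - u).
Proof. by rewrite -opprB ipnormN. Qed.

Lemma dot_sqr_le u v : dot u v ^+ 2 <= dot u u * dot v v.
Proof.
have [->|v0] := eqVneq v 0.
  by rewrite !dot0r mulr0 expr0n.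
have vv_gt0 : 0 < dot v v by exact: neq0_dnorm_gt0.
(* The component of u orthogonal to v, scaled by dot v v to avoid division. *)
have := dot_ge0 (dot v v *: u - dot u v *: v).
rewrite !dotE (dotC v u) => w_ge0.
rewrite -subr_ge0 -(pmulr_rge0 _ vv_gt0).
by apply: le_trans w_ge0 _; rewrite le_eqVlt; apply/orP; left; apply/eqP; ring.
Qed.

Lemma ipnorm_triangle u v :
  ipnorm dot (u + v) <= ipnorm dot u + ipnorm dot v.
Proof.
have uv_le : dot u v <= ipnorm dot u * ipnorm dot v.
  rewrite (le_trans (ler_norm _))// -(@ler_pXn2r _ 2) ?nnegrE//.
    by rewrite real_normK ?num_real// exprMn !ipnorm_sqr dot_sqr_le.
  by rewrite mulr_ge0 ?ipnorm_ge0.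
rewrite -(@ler_pXn2r _ 2) ?nnegrE ?addr_ge0 ?ipnorm_ge0//.
rewrite sqrrD !ipnorm_sqr !dotE (dotC v u); lra.
Qed.

Lemma ipnormB_le u v (M : R) : ipnorm dot u <= M -> ipnorm dot v <= M ->
  ipnorm dot (u - v) <= 2 * M.
Proof.
move=> uM vM; apply: le_trans (ipnorm_triangle _ _) _; rewrite ipnormN; lra.
Qed.

(** Both error sources enter through this bound: s is the size of the
    perturbation v, and 2 * M is the diameter of the ball containing the two
    points that u joins. *)
Lemma ipnorm_perturb u v (M s : R) :
  ipnorm dot u <= 2 * M -> ipnorm dot v <= s ->
  ipnorm dot (u + v) ^+ 2 <= ipnorm dot u ^+ 2 + s * (4 * M + s).
Proof.
move=> uM vs; have u0 := ipnorm_ge0 u; have v0 := ipnorm_ge0 v.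
apply: (@le_trans _ _ ((ipnorm dot u + s) ^+ 2)).
  rewrite ler_pXn2r ?nnegrE ?addr_ge0 ?ipnorm_ge0 ?(le_trans v0)//.
  by apply: le_trans (ipnorm_triangle _ _) _; rewrite lerD2l.
by rewrite sqrrD; nra.
Qed.

(** The squared norm is strongly convex, with an exact defect: the cross terms
    2 a (1 - a) [dot u v] on the left are those of a (1 - a) ||u - v||^2. *)
Lemma ipnorm_conv a u v :
  ipnorm dot ((1 - a) *: u + a *: v) ^+ 2 =
  (1 - a) * ipnorm dot u ^+ 2 + a * ipnorm dot v ^+ 2
  - a * (1 - a) * ipnorm dot (u - v) ^+ 2.
Proof. by rewrite !ipnorm_sqr !dotE (dotC v u); ring. Qed.

(** * Relaxed operators *)

Implicit Types (S Shat : 'rV[R]_m -> 'rV[R]_m) (D : set 'rV[R]_m).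

Lemma relaxB a S x y :
  relax a S x - y = (1 - a) *: (x - y) + a *: (S x - y).
Proof. by apply/rowP => i; rewrite !mxE; ring. Qed.

Lemma subr_relax a S x : x - relax a S x = a *: (x - S x).
Proof. by apply/rowP => i; rewrite !mxE; ring. Qed.

Lemma relax_fix a S x : a != 0 -> x = relax a S x -> S x = x.
Proof.
move=> a0 /eqP; rewrite -subr_eq0 subr_relax scaler_eq0 (negPf a0) /= subr_eq0.
by move/eqP.
Qed.

Lemma relax_set_fun a S D : convex_set D -> 0 < a < 1 ->
  set_fun D D S -> set_fun D D (relax a S).
Proof.
move=> Dconv /andP[a0 a1] SD x Dx.
(* The weight of a convex combination is an element of {i01 R}, which packs a
   with this membership proof. *)
have a01 : Itv.spec (@Itv.num_sem R) (Itv.Real `[0%Z, 1%Z]) a.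
  by rewrite /= /Itv.num_sem /= num_real /= in_itv /= !ltW.
have := Dconv (S x) x (Itv.mk a01) (mem_set (SD _ Dx)) (mem_set Dx).
by move/set_mem; rewrite /relax addrC.
Qed.

(** Since y is also fixed by S, both S x - y and x - y have length at most
    ||x - y||, and [ipnorm_conv] keeps the defect at (x - y) - (S x - y). *)
Lemma relax_fejer a S D x y : 0 < a < 1 -> nonexpansive_in dot D S ->
  D x -> D y -> y = relax a S y ->
  ipnorm dot (relax a S x - y) ^+ 2 <=
  ipnorm dot (x - y) ^+ 2 - a * (1 - a) * ipnorm dot (x - S x) ^+ 2.
Proof.
move=> /andP[a0 a1] Snonexp Dx Dy yfix.
have Sy : S y = y by apply: relax_fix yfix; rewrite gt_eqF.
rewrite relaxB ipnorm_conv opprB addrA subrK lerD2r.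
have Sxy : ipnorm dot (S x - y) ^+ 2 <= ipnorm dot (x - y) ^+ 2.
  by rewrite ler_pXn2r ?nnegrE ?ipnorm_ge0// -{1}Sy Snonexp.
nra.
Qed.

(** The change of the potential over one step: y is the current fixed point and
    z the next one.  All three points y, relax a S x and relax a Shat x lie in the
    ball of radius M, which is what [ipnorm_perturb] needs for both errors. *)
Lemma inexact_step a S Shat D (e M s : R) x y z :
  0 < a < 1 -> nonexpansive_in dot D S -> D x -> D y -> y = relax a S y ->
  ipnorm dot (S x - Shat x) <= e ->
  ipnorm dot y <= M -> ipnorm dot (relax a S x) <= M ->
  ipnorm dot (relax a Shat x) <= M ->
  ipnorm dot (z - y) <= s ->
  a * (1 - a) * ipnorm dot (x - S x) ^+ 2 <=
  ipnorm dot (x - y) ^+ 2 - ipnorm dot (relax a Shat x - z) ^+ 2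
  + residual a e M s.
Proof.
move=> a01 Snonexp Dx Dy yfix err yM FM FhatM drift.
have fejer := relax_fejer a01 Snonexp Dx Dy yfix.
have inexact : ipnorm dot (relax a Shat x - y) ^+ 2 <=
    ipnorm dot (relax a S x - y) ^+ 2 + a * e * (4 * M + a * e).
  have -> : relax a Shat x - y = (relax a S x - y) + a *: (Shat x - S x).
    by apply/rowP => i; rewrite !mxE; ring.
  case/andP: a01 => a0 _.
  apply: ipnorm_perturb; first exact: ipnormB_le.
  by rewrite (ipnormZ_ge0 _ (ltW a0)) ler_pM2l// ipdistC.
have drifted : ipnorm dot (relax a Shat x - z) ^+ 2 <=
    ipnorm dot (relax a Shat x - y) ^+ 2 + s * (4 * M + s).
  have -> : relax a Shat x - z = (relax a Shat x - y) + (y - z).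
    by rewrite addrA subrK.
  by apply: ipnorm_perturb; [exact: ipnormB_le | rewrite ipdistC].
rewrite /residual; lra.
Qed.

End InnerProduct.

(** * Summation over the steps *)

Lemma residual_le (R : realType) (a e M s a' e' M' s' : R) :
  0 <= a <= a' -> 0 <= e <= e' -> 0 <= M <= M' -> 0 <= s <= s' ->
  residual a e M s <= residual a' e' M' s'.
Proof.
move=> /andP[a0 aa'] /andP[e0 ee'] /andP[M0 MM'] /andP[s0 ss'].
have ae_le : a * e <= a' * e' by rewrite ler_pM.
have ae0 : 0 <= a * e by rewrite mulr_ge0.
have ball_le c c' : 0 <= c -> c <= c' -> c * (4 * M + c) <= c' * (4 * M' + c').
  by move=> c0 cc'; rewrite ler_pM ?addr_ge0 ?mulr_ge0// lerD// ler_wpM2l.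
by rewrite /residual lerD ?ball_le.
Qed.

(** The set of step values is finite, hence bounded above; without an upper bound
    [sup] would take a default value. *)
Lemma le_sup_steps (R : realType) (T : nat) (u : nat -> R) (t : nat) :
  (1 <= t <= T)%N -> u t <= sup_steps T u.
Proof.
move=> tT; apply: ub_le_sup; last by exists t.
exists (\sum_(i < T.+1) `|u i|) => _ [i /= /andP[_ iT] <-].
rewrite (bigD1 (Ordinal (iT : (i < T.+1)%N)))//=.
by rewrite (le_trans (ler_norm _))// lerDl sumr_ge0.
Qed.

Lemma sum_le_telescope (R : numDomainType) (T : nat) (c V r : nat -> R) :
  (forall t, (1 <= t <= T)%N -> c t <= V t - V t.+1 + r t) -> 0 <= V T.+1 ->
  \sum_(1 <= t < T.+1) c t <= V 1%N + \sum_(1 <= t < T.+1) r t.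
Proof.
move=> step V0.
apply: le_trans (@ler_sum_nat _ 1 T.+1 _ _ step) _.
rewrite big_split/= lerD2r.
rewrite -[X in X <= _]opprK -sumrN.
under eq_bigr do rewrite opprB.
by rewrite telescope_sumr// opprB lerBlDr lerDl.
Qed.

Lemma average_le (R : numFieldType) (T : nat) (c r : nat -> R) (A rmax : R) :
  (1 <= T)%N ->
  \sum_(1 <= t < T.+1) c t <= A + \sum_(1 <= t < T.+1) r t ->
  (forall t, (1 <= t <= T)%N -> r t <= rmax) ->
  T%:R^-1 * \sum_(1 <= t < T.+1) c t <= T%:R^-1 * A + rmax.
Proof.
move=> T1 sum_le r_le; have T0 : 0 < T%:R :> R by rewrite ltr0n.
have r_sum : \sum_(1 <= t < T.+1) r t <= T%:R * rmax.
  apply: le_trans (@ler_sum_nat _ 1 T.+1 _ _ r_le) _.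
  by rewrite sumr_const_nat subSS subn0 mulr_natl.
rewrite ler_pdivrMl// mulrDr mulVKf ?gt_eqF//.
by apply: (le_trans sum_le); rewrite lerD2l.
Qed.

Theorem theorem1 (R : realType) (m : nat) (dot : {dot 'rV[R]_m for idfun})
  (D : set 'rV[R]_m)
  (D_nonempty : D !=set0) (D_closed : closed D) (D_convex : convex_set D)
  (T : nat) (T_ge1 : (1 <= T)%N)
  (alpha : nat -> R)
  (alpha_in01 : forall t, (1 <= t <= T)%N -> 0 < alpha t < 1)
  (Top : nat -> 'rV[R]_m -> 'rV[R]_m)
  (Top_fun : forall t, (1 <= t <= T)%N -> set_fun D D (Top t))
  (Top_nonexp : forall t, (1 <= t <= T)%N -> nonexpansive_in dot D (Top t))
  (xstar : nat -> 'rV[R]_m)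
  (xstar_in : forall t, (1 <= t <= T)%N -> D (xstar t))
  (xstar_fix : forall t, (1 <= t <= T)%N ->
     xstar t = relax (alpha t) (Top t) (xstar t))
  (sigma : nat -> R)
  (sigma_ge0 : forall t, (1 <= t <= T)%N -> 0 <= sigma t)
  (xstar_drift : forall t, (1 <= t < T)%N ->
     ipnorm dot (xstar t.+1 - xstar t) <= sigma t)
  (That : nat -> 'rV[R]_m -> 'rV[R]_m)
  (That_fun : forall t, (1 <= t <= T)%N -> set_fun D D (That t))
  (e : nat -> R)
  (approx_error : forall t, (1 <= t <= T)%N ->
     forall x, D x -> ipnorm dot (Top t x - That t x) <= e t)
  (L : nat -> R)
  (L_in01 : forall t, (1 <= t <= T)%N -> 0 <= L t <= 1)
  (F_lipschitz : forall t, (1 <= t <= T)%N ->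
     lipschitz_in dot D (L t) (relax (alpha t) (Top t)))
  (M : nat -> R)
  (F_bounded : forall t, (1 <= t <= T)%N ->
     forall x, D x -> ipnorm dot (relax (alpha t) (Top t) x) <= M t)
  (Fhat_bounded : forall t, (1 <= t <= T)%N ->
     forall x, D x -> ipnorm dot (relax (alpha t) (That t) x) <= M t)
  (x : nat -> 'rV[R]_m)
  (x1_in : D (x 1%N))
  (x_step : forall t, (1 <= t <= T)%N ->
     x t.+1 = relax (alpha t) (That t) (x t)) :
  [/\ \sum_(1 <= t < T.+1)
          alpha t * (1 - alpha t) * ipnorm dot (x t - Top t (x t)) ^+ 2
        <= ipnorm dot (x 1%N - xstar 1%N) ^+ 2
           + \sum_(1 <= t < T.+1)
               residual (alpha t) (e t) (M t) (sigma t),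
      T%:R^-1 * \sum_(1 <= t < T.+1)
          alpha t * (1 - alpha t) * ipnorm dot (x t - Top t (x t)) ^+ 2
        <= T%:R^-1 * ipnorm dot (x 1%N - xstar 1%N) ^+ 2
           + residual (sup_steps T alpha) (sup_steps T e)
                      (sup_steps T M) (sup_steps T sigma)
    & T%:R^-1 * \sum_(1 <= t < T.+1)
          (1 - alpha t) / alpha t
            * ipnorm dot (x t - relax (alpha t) (Top t) (x t)) ^+ 2
        <= T%:R^-1 * ipnorm dot (x 1%N - xstar 1%N) ^+ 2
           + residual (sup_steps T alpha) (sup_steps T e)
                      (sup_steps T M) (sup_steps T sigma) ].
Proof.
have [x0 Dx0] := D_nonempty.
have e_ge0 t : (1 <= t <= T)%N -> 0 <= e t.
  by move=> tT; apply: le_trans (approx_error _ tT _ Dx0); exact: ipnorm_ge0.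
have M_ge0 t : (1 <= t <= T)%N -> 0 <= M t.
  by move=> tT; apply: le_trans (F_bounded _ tT _ Dx0); exact: ipnorm_ge0.
have x_in t : (1 <= t <= T)%N -> D (x t).
  elim: t => // -[_ //|t IH] tT; have tT' : (1 <= t.+1 <= T)%N by exact: ltnW.
  rewrite x_step//; apply: (relax_set_fun D_convex (alpha_in01 _ tT')) (IH tT').
  exact: That_fun.
(* Freezing the fixed point after time T makes the drift bound hold at t = T too,
   where it reads 0 <= sigma T. *)
pose y t := xstar (minn t T).
have yE t : (t <= T)%N -> y t = xstar t by rewrite /y => /minn_idPl ->.
have y_drift t : (1 <= t <= T)%N -> ipnorm dot (y t.+1 - y t) <= sigma t.
  move=> /andP[t1]; rewrite leq_eqVlt => /orP[/eqP tT|tT]; last first.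
    by rewrite !yE ?(ltnW tT)// xstar_drift// t1.
  rewrite /y tT minnn (minn_idPr (leqnSn T)) subrr /ipnorm dot0l sqrtr0.
  by rewrite sigma_ge0// T_ge1 leqnn.
have regret : \sum_(1 <= t < T.+1)
    alpha t * (1 - alpha t) * ipnorm dot (x t - Top t (x t)) ^+ 2
    <= ipnorm dot (x 1%N - xstar 1%N) ^+ 2
       + \sum_(1 <= t < T.+1) residual (alpha t) (e t) (M t) (sigma t).
  rewrite -(yE _ T_ge1).
  apply: (sum_le_telescope (V := fun t => ipnorm dot (x t - y t) ^+ 2)); last first.
    exact: sqr_ge0.
  move=> t tT; have /andP[_ /yE yt] := tT; rewrite x_step//.
  have yM : ipnorm dot (xstar t) <= M t.
    by rewrite (xstar_fix _ tT); apply: F_bounded (xstar_in _ tT).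
  apply: (inexact_step (D := D)); rewrite ?yt; auto.
  by rewrite -yt y_drift.
have res_le t : (1 <= t <= T)%N -> residual (alpha t) (e t) (M t) (sigma t) <=
    residual (sup_steps T alpha) (sup_steps T e)
             (sup_steps T M) (sup_steps T sigma).
  move=> tT; have /andP[a0 _] := alpha_in01 _ tT.
  by apply: residual_le; rewrite le_sup_steps// andbT ?(ltW a0)//; auto.
have average := average_le T_ge1 regret res_le.
split=> //; apply: le_trans average.
rewrite le_eqVlt; apply/orP; left; apply/eqP; congr (_ * _).
apply: eq_big_nat => t tT; have /andP[a0 _] := alpha_in01 _ tT.
by rewrite subr_relax ipnormZ_sqr; field; rewrite gt_eqF.
Qed.
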